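(* Let $G$ and $A$ be finite groups acting on each other (and on themselves by conjugation). If the mutual actions are half compatible, then the nonabelian homology groups $H_i(G,A)$ are finite for $i=0,1$.
   Context: All actions are left actions by automorphisms. $G$ acts on $A$ and $A$ acts on $G$, and each group acts on itself by conjugation; ${}^{x}y$ denotes the result of acting by $x$ on $y$. Consequently the free product $G*A$ acts on $G$ and on $A$. The mutual actions are half compatible if at least one of the following two conditions holds: (1) ${}^{({}^{a}g)}a'={}^{a}\big({}^{g}({}^{a^{-1}}a')\big)$ for all $g\in G$, $a,a'\in A$; (2) ${}^{({}^{g}a)}g'={}^{g}\big({}^{a}({}^{g^{-1}}g')\big)$ for all $g,g'\in G$, $a\in A$. Inassaridze's tensor product $G\otimes A$ is the group generated by the symbols $g\otimes a$ ($g\in G$, $a\in A$) subject to the relations $gg'\otimes a=({}^{g}g'\otimes{}^{g}a)(g\otimes a)$, $g\otimes aa'=(g\otimes a)({}^{a}g\otimes{}^{a}a')$ and $(g\otimes a)(g'\otimes a')(g\otimes a)^{-1}={}^{[g,a]}g'\otimes{}^{[g,a]}a'$ for all $g,g'\in G$, $a,a'\in A$, where $[g,a]=gag^{-1}a^{-1}\in G*A$. Let $A'$ be the normal subgroup of $A$ generated by the elements ${}^{({}^{a}g)}a'\cdot\big({}^{aga^{-1}}a'\big)^{-1}$ for all $a,a'\in A$, $g\in G$ (with $aga^{-1}\in G*A$), and let $f\colon G\otimes A\to A/A'$ be the homomorphism with $f(g\otimes a)={}^{g}a\,a^{-1}A'$. The low-dimensional nonabelian homology groups (in the sense of N. Inassaridze)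 are $H_1(G,A)=\ker f$ and $H_0(G,A)=\mathrm{coker} f$ (the image of $f$ is normal in $A/A'$). *)

(* Defs.v *)
(* All groups are [groupType]s, which may be infinite. *)
From Stdlib Require Import Relation_Operators.
From HB Require Import structures.
From mathcomp Require Import all_boot fingroup.
From mathcomp Require Import boolp classical_sets cardinality.

Set Implicit Arguments.
Unset Strict Implicit.
Unset Printing Implicit Defensive.

Import GroupScope.
Local Open Scope group_scope.
Local Open Scope quotient_scope.
Local Open Scope classical_set_scope.

(** ** Normal subgroups and quotients *)

Section NormalSubgroup.
Variable K : groupType.

Definition normal_subgroup (N : set K) : Prop :=
  [/\ N 1, forall x y, N x -> N y -> N (x * y),
      forall x, N x -> N x^-1 & forall x y, N x -> N (y * x * y^-1)].

Record normalSubgroup := NormalSubgroup {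
  normal_set : set K;
  normal_setP : normal_subgroup normal_set }.

(* [smallest] is the intersection of all normal subgroups containing S. *)
Lemma normal_closure_subproof (S : set K) :
  normal_subgroup (smallest normal_subgroup S).
Proof.
split=> [|x y hx hy|x hx|x y hx] N [nN SN]; have [N1 NM NV NJ] := nN.
- exact: N1.
- by apply: NM; [exact: hx | exact: hy].
- by apply: NV; exact: hx.
- by apply: NJ; exact: hx.
Qed.

Definition normal_closure (S : set K) : normalSubgroup :=
  NormalSubgroup (normal_closure_subproof S).

Variable N : normalSubgroup.

Definition coset_eq (x y : K) : bool := `[< normal_set N (x * y^-1) >].

Lemma coset_eq_equiv : equiv_class_of coset_eq.
Proof.
have [N1 NM NV NJ] := normal_setP N.
split=> [x|x y|y x z].
- by apply/asboolP; rewrite mulgV.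
- by apply/asboolP/asboolP => /NV; rewrite invgM invgK.
- by move=> /asboolP h1 /asboolP h2; apply/asboolP; have := NM _ _ h1 h2;
    rewrite mulgA mulgKV.
Qed.

Canonical coset_equiv := EquivRelPack coset_eq_equiv.

Definition quotient_group := {eq_quot coset_equiv}.
HB.instance Definition _ := Choice.on quotient_group.

Definition to_quotient (x : K) : quotient_group := \pi_{eq_quot coset_equiv} x.

Definition quotient_repr (q : quotient_group) : K :=
  generic_quotient.repr (q : {eq_quot coset_equiv}).

Lemma quotient_reprK q : to_quotient (quotient_repr q) = q.
Proof. exact: reprK. Qed.

Lemma to_quotientP x y :
  to_quotient x = to_quotient y <-> normal_set N (x * y^-1).
Proof.
split=> [/eqquotP|h]; first by move=> /asboolP.
by apply/eqquotP/asboolP.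
Qed.

Definition quotient_mul (p q : quotient_group) : quotient_group :=
  to_quotient (quotient_repr p * quotient_repr q).
Definition quotient_inv (p : quotient_group) : quotient_group :=
  to_quotient (quotient_repr p)^-1.

Lemma quotient_mulE x y :
  quotient_mul (to_quotient x) (to_quotient y) = to_quotient (x * y).
Proof.
have [N1 NM NV NJ] := normal_setP N.
apply/to_quotientP.
have /to_quotientP hx := quotient_reprK (to_quotient x).
have /to_quotientP hy := quotient_reprK (to_quotient y).
set x' := quotient_repr (to_quotient x) in hx *.
set y' := quotient_repr (to_quotient y) in hy *.
have -> : x' * y' * (x * y)^-1 = x' * (y' * y^-1) * x'^-1 * (x' * x^-1).
  by rewrite invgM !mulgA mulgKV.
by apply: NM => //; exact: NJ.
Qed.

Lemma quotient_invE x : quotient_inv (to_quotient x) = to_quotient x^-1.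
Proof.
have [N1 NM NV NJ] := normal_setP N.
apply/to_quotientP; rewrite invgK.
have /to_quotientP hx := quotient_reprK (to_quotient x).
set x' := quotient_repr (to_quotient x) in hx *.
have := NJ _ x'^-1 (NV _ hx).
by rewrite invgM !invgK !mulgA mulgKV.
Qed.

Let mulgA_subproof : associative quotient_mul.
Proof.
move=> p q r; rewrite -(quotient_reprK p) -(quotient_reprK q) -(quotient_reprK r).
by rewrite !quotient_mulE mulgA.
Qed.
Let mul1g_subproof : left_id (to_quotient 1) quotient_mul.
Proof. by move=> p; rewrite -(quotient_reprK p) quotient_mulE mul1g. Qed.
Let mulg1_subproof : right_id (to_quotient 1) quotient_mul.
Proof. by move=> p; rewrite -(quotient_reprK p) quotient_mulE mulg1. Qed.
Let mulVg_subproof : left_inverse (to_quotient 1) quotient_inv quotient_mul.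
Proof.
by move=> p; rewrite -(quotient_reprK p) quotient_invE quotient_mulE mulVg.
Qed.
Let mulgV_subproof : right_inverse (to_quotient 1) quotient_inv quotient_mul.
Proof.
by move=> p; rewrite -(quotient_reprK p) quotient_invE quotient_mulE mulgV.
Qed.

HB.instance Definition _ := isGroup.Build quotient_group
  mulgA_subproof mul1g_subproof mulg1_subproof mulVg_subproof mulgV_subproof.

Lemma to_quotientM x y : to_quotient (x * y) = to_quotient x * to_quotient y.
Proof. by rewrite -quotient_mulE. Qed.
Lemma to_quotientV x : to_quotient x^-1 = (to_quotient x)^-1.
Proof. by rewrite -quotient_invE. Qed.
Lemma to_quotient1 : to_quotient 1 = 1. Proof. by []. Qed.

End NormalSubgroup.

Arguments to_quotient {K} N x.

Section QuotientLift.
Variables (K H : groupType) (S : set K) (f : K -> H).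

(* Only meaningful when f is a morphism that is trivial on S. *)
Definition quotient_lift (q : quotient_group (normal_closure S)) : H :=
  f (quotient_repr q).

Hypothesis fM : {morph f : x y / x * y}.
Hypothesis fS : forall x, S x -> f x = 1.

Let f1 : f 1 = 1.
Proof. by apply: (mulgI (f 1)); rewrite -fM !mulg1. Qed.
Let fV x : f x^-1 = (f x)^-1.
Proof. by apply: (mulgI (f x)); rewrite -fM !mulgV. Qed.

Lemma normal_closure_ker x : normal_set (normal_closure S) x -> f x = 1.
Proof.
move=> /(_ [set x | f x = 1]); apply; split=> //; split=> //= [u v|u|u v].
- by rewrite fM => -> ->; rewrite mulg1.
- by rewrite fV => ->; rewrite invg1.
- by rewrite !fM fV => ->; rewrite mulg1 mulgV.
Qed.

Lemma quotient_liftE x : quotient_lift (to_quotient _ x) = f x.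
Proof.
have /to_quotientP /normal_closure_ker :=
  quotient_reprK (to_quotient (normal_closure S) x).
by rewrite fM fV => /(canRL (mulgK _)); rewrite mul1g invgK.
Qed.

Lemma quotient_liftM : {morph quotient_lift : p q / p * q}.
Proof.
move=> p q; rewrite -(quotient_reprK p) -(quotient_reprK q) -to_quotientM.
by rewrite !quotient_liftE fM.
Qed.

End QuotientLift.

(** ** Free groups: words in the letters x, x^-1 modulo cancellation *)

Section FreeGroup.
Variable X : choiceType.

(* (x, true) stands for the letter x and (x, false) for x^-1. *)
Definition word := seq (X * bool).

Inductive word_cancel : word -> word -> Prop :=
| WordCancel (u v : word) (x : X) (b : bool) :
    word_cancel (u ++ [:: (x, b); (x, ~~ b)] ++ v) (u ++ v).

Definition word_eqP : word -> word -> Prop := clos_refl_sym_trans word word_cancel.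

Definition word_eq (u v : word) : bool := `[< word_eqP u v >].

Lemma word_eq_equiv : equiv_class_of word_eq.
Proof.
split=> [x|x y|y x z].
- by apply/asboolP; exact: rst_refl.
- by apply/asboolP/asboolP => h; exact: rst_sym.
- by move=> /asboolP h1 /asboolP h2; apply/asboolP; exact: rst_trans h1 h2.
Qed.

Canonical word_equiv := EquivRelPack word_eq_equiv.

Definition free_group := {eq_quot word_equiv}.
HB.instance Definition _ := Choice.on free_group.

Definition of_word (w : word) : free_group := \pi_{eq_quot word_equiv} w.
Definition free_repr (q : free_group) : word := generic_quotient.repr (q : {eq_quot word_equiv}).

Lemma free_reprK q : of_word (free_repr q) = q.
Proof. exact: reprK. Qed.

Lemma of_wordP u v : of_word u = of_word v <-> word_eqP u v.
Proof.
split=> [/eqquotP|h]; first by move=> /asboolP.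
by apply/eqquotP/asboolP.
Qed.

Lemma word_eqP_cat u u' v v' :
  word_eqP u u' -> word_eqP v v' -> word_eqP (u ++ v) (u' ++ v').
Proof.
move=> hu hv; apply: (rst_trans _ _ _ (u' ++ v)).
  elim: hu => {u u'} [_ _ [s t x b]|s|s t _ h|s t r _ h1 _ h2].
  - by rewrite -!catA; apply: rst_step; exact: (WordCancel s (t ++ v)).
  - exact: rst_refl.
  - exact: rst_sym.
  - exact: rst_trans h1 h2.
elim: hv => {v v'} [_ _ [s t x b]|s|s t _ h|s t r _ h1 _ h2].
- by rewrite !(catA u'); apply: rst_step; exact: WordCancel.
- exact: rst_refl.
- exact: rst_sym.
- exact: rst_trans h1 h2.
Qed.

Definition word_inv (w : word) : word := rev [seq (p.1, ~~ p.2) | p <- w].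

Lemma word_eqP_inv u v : word_eqP u v -> word_eqP (word_inv u) (word_inv v).
Proof.
elim=> {u v} [_ _ [s t x b]|s|s t _ h|s t r _ h1 _ h2].
- rewrite /word_inv !map_cat !rev_cat /= negbK -catA.
  exact: rst_step (WordCancel _ _ x b).
- exact: rst_refl.
- exact: rst_sym.
- exact: rst_trans h1 h2.
Qed.

Lemma word_mulV u : word_eqP (u ++ word_inv u) [::].
Proof.
elim: u => [|[x b] u ih]; first exact: rst_refl.
rewrite /word_inv map_cons rev_cons -cats1 /=.
apply: (rst_trans _ _ _ ([:: (x, b)] ++ [::] ++ [:: (x, ~~ b)])).
  rewrite catA -cat1s; apply: word_eqP_cat; first exact: rst_refl.
  by apply: word_eqP_cat; [exact: ih | exact: rst_refl].
exact: (rst_step _ _ _ _ (WordCancel [::] [::] x b)).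
Qed.

Lemma word_invK : involutive word_inv.
Proof.
move=> u; rewrite /word_inv map_rev revK -map_comp map_id_in //.
by move=> [x b] _ /=; rewrite negbK.
Qed.

Lemma word_mulVl u : word_eqP (word_inv u ++ u) [::].
Proof. by rewrite -{2}(word_invK u); exact: word_mulV. Qed.

Definition free_mul (p q : free_group) : free_group :=
  of_word (free_repr p ++ free_repr q).
Definition free_inv (p : free_group) : free_group :=
  of_word (word_inv (free_repr p)).

Lemma free_mulE u v : free_mul (of_word u) (of_word v) = of_word (u ++ v).
Proof.
by apply/of_wordP; apply: word_eqP_cat; apply/of_wordP; exact: free_reprK.
Qed.

Lemma free_invE u : free_inv (of_word u) = of_word (word_inv u).
Proof. by apply/of_wordP/word_eqP_inv/of_wordP; exact: free_reprK. Qed.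

Let mulgA_subproof : associative free_mul.
Proof.
move=> p q r; rewrite -(free_reprK p) -(free_reprK q) -(free_reprK r).
by rewrite !free_mulE catA.
Qed.
Let mul1g_subproof : left_id (of_word [::]) free_mul.
Proof. by move=> p; rewrite -(free_reprK p) free_mulE. Qed.
Let mulg1_subproof : right_id (of_word [::]) free_mul.
Proof. by move=> p; rewrite -(free_reprK p) free_mulE cats0. Qed.
Let mulVg_subproof : left_inverse (of_word [::]) free_inv free_mul.
Proof.
move=> p; rewrite -(free_reprK p) free_invE free_mulE.
exact/of_wordP/word_mulVl.
Qed.
Let mulgV_subproof : right_inverse (of_word [::]) free_inv free_mul.
Proof.
move=> p; rewrite -(free_reprK p) free_invE free_mulE.
exact/of_wordP/word_mulV.
Qed.

HB.instance Definition _ := isGroup.Build free_group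
  mulgA_subproof mul1g_subproof mulg1_subproof mulVg_subproof mulgV_subproof.

Definition free_gen (x : X) : free_group := of_word [:: (x, true)].

Variables (H : groupType) (h : X -> H).

Definition word_eval (w : word) : H :=
  foldr (fun p z => (if p.2 then h p.1 else (h p.1)^-1) * z) 1 w.

Definition free_lift (q : free_group) : H := word_eval (free_repr q).

Lemma word_eval_cat u v : word_eval (u ++ v) = word_eval u * word_eval v.
Proof. by elim: u => [|p u ih] /=; rewrite ?mul1g // ih mulgA. Qed.

Lemma word_eval_eq u v : word_eqP u v -> word_eval u = word_eval v.
Proof.
elim=> {u v} // [_ _ [s t x b]|s t r _ -> //].
rewrite !word_eval_cat /= mulg1 mulgA; congr (_ * _).
by case: b => /=; rewrite ?mulgV ?mulVg mulg1.
Qed.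

Lemma free_liftE w : free_lift (of_word w) = word_eval w.
Proof. by apply: word_eval_eq; apply/of_wordP; exact: free_reprK. Qed.

Lemma free_lift_gen x : free_lift (free_gen x) = h x.
Proof. by rewrite free_liftE /= mulg1. Qed.

Lemma free_liftM : {morph free_lift : p q / p * q}.
Proof.
move=> p q; rewrite -(free_reprK p) -(free_reprK q).
by rewrite [X in free_lift X]free_mulE !free_liftE word_eval_cat.
Qed.

Lemma free_liftV p : free_lift p^-1 = (free_lift p)^-1.
Proof.
have l1 : free_lift 1 = 1 by rewrite (free_liftE [::]).
by apply: (mulgI (free_lift p)); rewrite -free_liftM !mulgV.
Qed.

End FreeGroup.

(** ** Mutual actions *)

(* MathComp's own actions are right actions. *)
Record left_action (H K : groupType) := LeftAction {
  lact :> H -> K -> K;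
  lact1 : forall x, lact 1 x = x;
  lactM : forall h h' x, lact (h * h') x = lact h (lact h' x);
  lact_morph : forall h, {morph lact h : x y / x * y} }.

Definition lconj (K : groupType) (x y : K) : K := x * y * x^-1.

Lemma lconjK (K : groupType) (x : K) : cancel (lconj x) (lconj x^-1).
Proof. by move=> y; rewrite /lconj invgK !mulgA mulVg mul1g mulgKV. Qed.
Lemma lconjVK (K : groupType) (x : K) : cancel (lconj x^-1) (lconj x).
Proof. by move=> y; rewrite /lconj invgK !mulgA mulgV mul1g mulgK. Qed.

Section NonabelianHomology.
Variables G A : groupType.
Variables (alpha : left_action G A) (beta : left_action A G).

(* A word in the letters of G + A represents an element of the free product of *)
(* G and A, which acts by composing the actions of its letters; the head letter *)
(* acts last. Each group acts on itself by conjugation.                        *)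
Definition freeprod_actG (w : seq (G + A)) (x : G) : G :=
  foldr (fun l y => match l with inl g => lconj g y | inr a => beta a y end) x w.
Definition freeprod_actA (w : seq (G + A)) (x : A) : A :=
  foldr (fun l y => match l with inl g => alpha g y | inr a => lconj a y end) x w.

Definition half_compatible : Prop :=
  (forall (g : G) (a a' : A),
     alpha (beta a g) a' = lconj a (alpha g (lconj a^-1 a')))
  \/
  (forall (g g' : G) (a : A),
     beta (alpha g a) g' = lconj g (beta a (lconj g^-1 g'))).

Definition mixed_comm (g : G) (a : A) : seq (G + A) :=
  [:: inl g; inr a; inl g^-1; inr a^-1].

Notation "g (x) a" := (free_gen ((g, a) : G * A)) (at level 30).

Inductive tensor_relation :
  free_group (G * A)%type -> free_group (G * A)%type -> Prop :=
| TensorMl g g' a :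
    tensor_relation ((g * g') (x) a) ((lconj g g' (x) alpha g a) * (g (x) a))
| TensorMr g a a' :
    tensor_relation (g (x) (a * a')) ((g (x) a) * (beta a g (x) lconj a a'))
| TensorJ g a g' a' :
    tensor_relation
      ((g (x) a) * (g' (x) a') * (g (x) a)^-1)
      (freeprod_actG (mixed_comm g a) g' (x) freeprod_actA (mixed_comm g a) a').

Definition tensor_relators : set (free_group (G * A)%type) :=
  [set w | exists u v, tensor_relation u v /\ w = u * v^-1].

Definition tensor_product := quotient_group (normal_closure tensor_relators).
HB.instance Definition _ := Group.on tensor_product.

Definition tensor (g : G) (a : A) : tensor_product :=
  to_quotient _ (g (x) a).

Definition A'_generators : set A :=
  [set x | exists (a a' : A) (g : G),
     x = alpha (beta a g) a' * (freeprod_actA [:: inr a; inl g; inr a^-1] a')^-1].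

Definition A' : normalSubgroup A := normal_closure A'_generators.

Definition A_mod_A' := quotient_group A'.
HB.instance Definition _ := Group.on A_mod_A'.

Definition f_gen (p : G * A) : A_mod_A' := to_quotient A' (alpha p.1 p.2 * p.2^-1).

(* The homomorphism with g (x) a |-> (g a) a^-1 A': see [f_hom_tensor]. *)
Definition f_hom : tensor_product -> A_mod_A' := @quotient_lift _ _ _ (free_lift f_gen).

Lemma lact_1 (H K : groupType) (s : left_action H K) h : s h 1 = 1.
Proof. by apply: (mulgI (s h 1)); rewrite -lact_morph !mulg1. Qed.
Lemma lact_V (H K : groupType) (s : left_action H K) h x : s h x^-1 = (s h x)^-1.
Proof. by apply: (mulgI (s h x)); rewrite -lact_morph !mulgV lact_1. Qed.
Lemma lactK (H K : groupType) (s : left_action H K) h : cancel (s h) (s h^-1).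
Proof. by move=> x; rewrite -lactM mulVg lact1. Qed.
Lemma lactVK (H K : groupType) (s : left_action H K) h : cancel (s h^-1) (s h).
Proof. by move=> x; rewrite -lactM mulgV lact1. Qed.

Notation cl := (to_quotient A').

Lemma A'_gen a g a' : cl (alpha (beta a g) a') = cl (lconj a (alpha g (lconj a^-1 a'))).
Proof.
by apply/to_quotientP => N [_ sub]; apply: sub; exists a, a', g.
Qed.

Lemma A'_stable h x : normal_set A' x -> normal_set A' (alpha h x).
Proof.
move=> /(_ [set x | normal_set A' (alpha h x)]); apply; have [N1 NM NV NJ] := normal_setP A'.
split=> [|_ /= [a [a' [g ->]]]].
  split=> /= [|u v hu hv|u hu|u v hu].
  - by rewrite lact_1.
  - by rewrite lact_morph; exact: NM.
  - by rewrite lact_V; exact: NV.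
  - by rewrite !lact_morph lact_V; exact: NJ.
rewrite lact_morph lact_V; apply/(to_quotientP A').
rewrite -lactM; set k := beta a^-1 h.
have hE : h = beta a k by rewrite lactVK.
rewrite [in LHS]hE -lact_morph A'_gen lactM.
set y := alpha g (lconj a^-1 a').
by rewrite -[y in LHS](lconjK a) -A'_gen -hE.
Qed.

Lemma A'_stableP h x y : cl x = cl y -> cl (alpha h x) = cl (alpha h y).
Proof.
move=> /to_quotientP /(A'_stable h); rewrite lact_morph lact_V => ?.
exact/to_quotientP.
Qed.

Lemma cl_lconjE x y : cl (lconj x y) = cl x * cl y * (cl x)^-1.
Proof. by rewrite [LHS]to_quotientM [cl (x * y)]to_quotientM to_quotientV. Qed.

Lemma cl_lconj x y z : cl y = cl z -> cl (lconj x y) = cl (lconj x z).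
Proof. by move=> yz; rewrite !cl_lconjE yz. Qed.

Lemma f_gen_relators w : tensor_relators w -> free_lift f_gen w = 1.
Proof.
suff h u v : tensor_relation u v -> free_lift f_gen u = free_lift f_gen v.
  by move=> [u [v [uv ->]]]; rewrite free_liftM free_liftV (h _ _ uv) mulgV.
case=> {u v} [g g' a|g a a'|g a g' a'];
  rewrite ?free_liftM ?free_liftV !free_lift_gen /f_gen /fst /snd.
- by rewrite -to_quotientM -!lactM /lconj mulgKV mulgA mulgKV.
- rewrite [cl (alpha (beta a g) _ * _)]to_quotientM A'_gen -!to_quotientM.
  rewrite lact_morph.
  by rewrite lconjK /lconj !invgM invgK !mulgA !mulgKV.
- rewrite [freeprod_actG _ _]/= [freeprod_actA _ _]/=.
  set c := alpha g a * a^-1.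
  have cE y : alpha g (lconj a (alpha g^-1 (lconj a^-1 y))) = lconj c y.
    rewrite /lconj /c !(lact_morph, lact_V) -!lactM mulgV !lact1.
    by rewrite !invgM !invgK !mulgA.
  rewrite cE [in RHS]to_quotientM.
  have -> : lconj g (beta a (lconj g^-1 (beta a^-1 g')))
    = g * (beta a g^-1 * g' * beta a g) * g^-1.
    by rewrite /lconj !lact_morph lactVK invgK.
  have key : cl (alpha (g * (beta a g^-1 * g' * beta a g) * g^-1) (lconj c a'))
           = cl (lconj c (alpha g' a')).
    rewrite !lactM -[in RHS]cE.
    apply: A'_stableP; rewrite A'_gen; apply: cl_lconj.
    apply: A'_stableP; apply: cl_lconj; apply: A'_stableP.
    by rewrite A'_gen -cE lactK lconjK lactVK lconjVK.
  rewrite key to_quotientV !cl_lconjE [cl (alpha g' a' * _)]to_quotientM.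
  by rewrite to_quotientV !invgM invgK !mulgA mulgKV.
Qed.

Lemma f_hom_tensor g a : f_hom (tensor g a) = to_quotient A' (alpha g a * a^-1).
Proof.
rewrite /f_hom /tensor quotient_liftE; last exact: f_gen_relators.
  exact: free_lift_gen.
exact: free_liftM.
Qed.

Lemma f_homM : {morph f_hom : x y / x * y}.
Proof. exact: (quotient_liftM (@free_liftM _ _ _) f_gen_relators). Qed.
Lemma f_hom1 : f_hom 1 = 1.
Proof. by apply: (mulgI (f_hom 1)); rewrite -f_homM !mulg1. Qed.
Lemma f_homV x : f_hom x^-1 = (f_hom x)^-1.
Proof. by apply: (mulgI (f_hom x)); rewrite -f_homM !mulgV f_hom1. Qed.
Lemma f_hom_div : {morph f_hom : x y / x * y^-1}.
Proof. by move=> x y; rewrite f_homM f_homV. Qed.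

HB.instance Definition _ :=
  isGroupMorphism.Build tensor_product A_mod_A' f_hom f_hom_div.

Lemma f_hom_ker_closed : group_closed [pred x : tensor_product | f_hom x == 1].
Proof.
split=> [|x y]; rewrite !inE; first by rewrite f_hom1.
by move=> /eqP fx /eqP fy; rewrite f_homM f_homV fx fy mulgV.
Qed.

(* ker f_hom *)
Record H1 : Type := H1_of { H1_val : tensor_product; _ : f_hom H1_val == 1 }.
HB.instance Definition _ := [isSub for H1_val].
HB.instance Definition _ := [Choice of H1 by <:].
HB.instance Definition _ :=
  SubChoice_isSubGroup.Build tensor_product _ H1 f_hom_ker_closed.

Lemma f_hom_image_normal : normal_subgroup (range f_hom).
Proof.
split=> [|_ _ [x _ <-] [y _ <-]|_ [x _ <-]|_ z [x _ <-]].
- by exists 1 => //; rewrite f_hom1.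
- by exists (x * y) => //; rewrite f_homM.
- by exists x^-1 => //; rewrite f_homV.
suff [t ->] : exists t, z * f_hom x * z^-1 = f_hom t by exists t.
have gen g a : exists t, z * f_hom (tensor g a) * z^-1 = f_hom t.
  rewrite -(quotient_reprK z); set b := quotient_repr z.
  exists (tensor (beta b g) (lconj b a)).
  rewrite !f_hom_tensor [cl (alpha (beta b g) _ * _)]to_quotientM A'_gen lconjK.
  rewrite to_quotientV !cl_lconjE [cl (alpha g a * _)]to_quotientM.
  by rewrite to_quotientV !invgM invgK !mulgA mulgKV.
have -> : x = to_quotient _ (of_word (free_repr (quotient_repr x))).
  by rewrite free_reprK quotient_reprK.
elim: (free_repr _) => [|[[g a] b] w [t ih]].
  by exists 1; rewrite f_hom1 mulg1 mulgV.
have [u uE] := gen g a.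
have -> : to_quotient (normal_closure tensor_relators) (of_word ((g, a, b) :: w))
    = (if b then tensor g a else (tensor g a)^-1) * to_quotient _ (of_word w).
  have -> : of_word ((g, a, b) :: w)
    = (if b then free_gen (g, a) else (free_gen (g, a))^-1) * of_word w.
    by case: b; rewrite ?[(free_gen _)^-1]free_invE [RHS]free_mulE.
  by rewrite to_quotientM; case: b; rewrite ?to_quotientV.
exists ((if b then u else u^-1) * t).
rewrite !f_homM -ih; case: b.
  by rewrite -uE !mulgA mulgKV.
by rewrite !f_homV -uE !invgM invgK !mulgA mulgKV.
Qed.

Definition f_hom_image : normalSubgroup A_mod_A' := NormalSubgroup f_hom_image_normal.

(* coker f_hom *)
Definition H0 := quotient_group f_hom_image.
HB.instance Definition _ := Group.on H0.

End NonabelianHomology.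

(* Main.v *)
(** The symbols g (x) a form a finite set S which generates T = G (x) A and, by
    the third relation, is stable under conjugation; hence T acts on S with
    kernel the centre of T, which therefore has finite index.

    The images of the symbols in any abelian group are torsion: in additive
    notation, put x_a = sum_h h (x) a. Summing the first relation over g' gives
    x_a = x_(g a) + |G| (g (x) a), and summing the second one over g gives
    x_(a a') = x_a + x_(a a' a^-1), so that a |-> x_a is a morphism and
    |A| x_a = 0. Hence |G| |A| (g (x) a) = 0.

    The transfer T -> Z(T) raises central elements to the power [T : Z(T)], so
    the symbols have finite order in T itself, and T is finite by Dietzmann's
    lemma: in a word of minimal length representing an element of T, equal
    letters can be moved to the front, so none occurs as often as its order. *)

Require Import Defs.
From HB Require Import structures.
From mathcomp Require Import all_boot fingroup ssralg cyclic.
From mathcomp Require Import boolp classical_sets cardinality.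

Set Implicit Arguments.
Unset Strict Implicit.
Unset Printing Implicit Defensive.

Import GroupScope.
Local Open Scope group_scope.

(** * The centre as an abelian group *)

Section Center.
Variable T : groupType.

Definition central (z : T) : Prop := forall t, commute z t.

(** Written additively, so that the transfer becomes a [\sum] with values in a [zmodType]. *)
Definition center : Type := {z : T | `[< central z >]}.
HB.instance Definition _ := Choice.on center.

Lemma center_central (z : center) : central (val z).
Proof. exact/asboolP/(valP z). Qed.

Lemma central1 : central 1.
Proof. by move=> t; exact/commute_sym/commute1. Qed.
Lemma centralM x y : central x -> central y -> central (x * y).
Proof. by move=> cx cy t; apply/commute_sym/commuteM; apply/commute_sym. Qed.
Lemma centralV x : central x -> central x^-1.
Proof. by move=> cx t; apply/commute_sym/commuteV/commute_sym. Qed.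

Definition to_center (z : T) (cz : central z) : center := exist _ z (asboolT cz).

Definition center_zero : center := to_center central1.
Definition center_opp (x : center) : center :=
  to_center (centralV (center_central x)).
Definition center_add (x y : center) : center :=
  to_center (centralM (center_central x) (center_central y)).

Let addA : associative center_add.
Proof. by move=> x y z; apply: val_inj; rewrite /= mulgA. Qed.
Let addC : commutative center_add.
Proof. by move=> x y; apply: val_inj; exact: center_central. Qed.
Let add0 : left_id center_zero center_add.
Proof. by move=> x; apply: val_inj; rewrite /= mul1g. Qed.
Let addN : left_inverse center_zero center_opp center_add.
Proof. by move=> x; apply: val_inj; rewrite /= mulVg. Qed.
HB.instance Definition _ := GRing.isZmodule.Build center addA addC add0 addN.

Lemma val_centerMn (z : center) n : val (z *+ n)%R = val z ^+ n.
Proof. by elim: n => [|n ih]; rewrite // GRing.mulrS expgS -ih. Qed.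

End Center.

(** * Transfer into a centre of finite index *)

Section Transfer.
Variables (T : groupType) (X : finType) (c : T -> X).
Hypothesis cP : forall t u, c t = c u <-> central (t * u^-1).

Let r (q : X) : T := xget 1 [set t | c t = q]%classic.

Let rK u : c (r (c u)) = c u.
Proof. exact: (@xgetPex _ 1 [set t | c t = c u]%classic (ex_intro _ u erefl)). Qed.

Let d (u : T) : center T := to_center (proj1 (cP _ _) (esym (rK u))).

Let dE u : u = val (d u) * r (c u).
Proof. by rewrite /= mulgVK. Qed.

Let c_central z u : central z -> c (z * u) = c u.
Proof. by move=> cz; apply/cP; rewrite mulgK. Qed.

Let c_rep t u : c (t * r (c u)) = c (t * u).
Proof.
rewrite [u in RHS]dE mulgA -(center_central (d u)) -mulgA.
by rewrite [RHS]c_central //; exact: center_central.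
Qed.

Let d_central (z : center T) u : d (val z * u) = (z + d u)%R.
Proof.
by apply: val_inj; rewrite /= c_central ?mulgA //; exact: center_central.
Qed.

Definition transfer (t : T) : center T :=
  (\sum_(q | c (r q) == q) d (t * r q)%g)%R.

Lemma transferM : {morph transfer : t u / t * u >-> (t + u)%R}.
Proof.
move=> t u; rewrite {1}/transfer.
(* Left multiplication by [u] permutes the cosets, which allows reindexing the sum. *)
have -> : transfer t = (\sum_(q | c (r q) == q) d (t * r (c (u * r q)%g))%g)%R.
  rewrite /transfer.
  rewrite (reindex_onto (fun q => c (u * r q)) (fun q => c (u^-1 * r q))) /=.
    by apply: eq_bigl => q; rewrite rK eqxx /= c_rep mulKg.
  by move=> q /eqP qE; rewrite c_rep mulVKg.
rewrite -big_split; apply: eq_bigr => q _ /=.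
rewrite GRing.addrC -d_central mulgA (center_central _ t) -[in RHS]mulgA -dE.
by rewrite mulgA.
Qed.

(** A central element fixes every coset and contributes itself to each summand; [n] is the index of
    the centre. *)
Lemma transfer_central :
  exists2 n, 0 < n & forall z : center T, transfer (val z) = (z *+ n)%R.
Proof.
exists #|[pred q | c (r q) == q]|.
  by apply/card_gt0P; exists (c 1); rewrite inE rK.
move=> z; rewrite -GRing.sumr_const; apply: eq_bigr => q /eqP qE.
rewrite d_central; suff -> : d (r q) = 0%R by rewrite GRing.addr0.
by apply: val_inj; rewrite /= qE mulgV.
Qed.

(** By pigeonhole two of the powers [t ^+ 0], ..., [t ^+ #|X|] agree modulo the centre; the
    difference of their exponents divides the factorial of [#|X|]. *)
Lemma exp_central : exists2 n, 0 < n & forall t : T, central (t ^+ n).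
Proof.
exists (factorial #|X|) => [|t]; first exact: fact_gt0.
have /injectivePn [i [j ij eij]] :
    ~~ injectiveb (fun i : 'I_#|X|.+1 => c (t ^+ i)).
  apply/negP => /injectiveP /leq_card.
  by rewrite card_ord ltnn.
wlog lt_ji : i j ij eij / j < i => [wl|].
  have := ij; rewrite neq_ltn => /orP[|] lt; last exact: (wl i j).
  by apply: (wl j i) => //; rewrite eq_sym.
move/cP: eij; rewrite -expgnFr ?(ltnW lt_ji) // => cen.
have /dvdnP [k ->] : i - j %| factorial #|X|.
  apply: dvdn_fact; rewrite subn_gt0 lt_ji /=.
  by apply: leq_trans (leq_subr _ _) _; rewrite -ltnS.
rewrite mulnC expgnA => u.
exact/commute_sym/commuteX/commute_sym.
Qed.

End Transfer.

(** * Groups generated by a finite set stable under conjugation *)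

Section ConjugationClosed.
Variables (T : groupType) (S : seq T).
Hypothesis S_conj : {in S &, forall x y, y ^ x^-1 \in S}.
Hypothesis S_gen : forall P : T -> Prop, P 1 ->
  (forall s t, s \in S -> P t -> P (s * t)) ->
  (forall s t, s \in S -> P t -> P (s^-1 * t)) -> forall t, P t.

Lemma conj_gen t : {in S, forall y, y ^ t \in S}.
Proof.
have conjV s y : s \in S -> y \in S -> y ^ s \in S.
  (* Conjugation by [s^-1] is an injective self-map of the finite set [S], hence onto, so its
     inverse preserves [S] too. *)
  move=> sS yS.
  have uS : uniq (map (conjg^~ s^-1) (undup S)).
    by rewrite map_inj_uniq ?undup_uniq //; exact: conjg_inj.
  have sub : {subset map (conjg^~ s^-1) (undup S) <= undup S}.
    by move=> _ /mapP [x + ->]; rewrite !mem_undup; exact: S_conj.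
  have [|_ eS] := uniq_min_size uS sub; first by rewrite size_map.
  have := eS y; rewrite mem_undup yS => /mapP [x + ->].
  by rewrite mem_undup conjgKV.
elim/S_gen: t => [|s t sS ih|s t sS ih] y yS; first by rewrite conjg1.
  by rewrite conjgM; apply/ih/conjV.
by rewrite conjgM; apply/ih/S_conj.
Qed.

Lemma central_gen z : {in S, forall s, commute z s} -> central z.
Proof.
move=> cz; elim/S_gen => [|s t sS ih|s t sS ih]; first exact: commute1.
  by apply: commuteM ih; exact: cz.
by apply: commuteM ih; exact/commuteV/cz.
Qed.

Definition conj_action (t : T) : {ffun seq_sub S -> seq_sub S} :=
  [ffun x => SeqSub (conj_gen t (ssvalP x))].

(** Since [S] generates, acting trivially on [S] means being central; thus [conj_action] can serve
    as the coset labelling for the transfer. *)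
Lemma conj_actionP t u : conj_action t = conj_action u <-> central (t * u^-1).
Proof.
split=> [/ffunP e|cen].
  apply: central_gen => s sS; apply/commute_sym/commgP/conjg_fixP.
  by have := e (SeqSub sS); rewrite !ffunE conjgM => -[->]; rewrite conjgK.
apply/ffunP => x; apply: val_inj; rewrite !ffunE /= -[t](mulgVK u) conjgM.
by congr (_ ^ _); apply/conjg_fixP/commgP/commute_sym.
Qed.

(** By [y * x = x * y ^ x], moving [x] to the front conjugates the letters it passes. These stay in
    [S], and the other occurrences of [x] survive because [x ^ x = x]. *)
Lemma count_front x j (w : seq T) : {subset w <= S} -> x \in S ->
  j <= count_mem x w ->
  exists w', [/\ {subset w' <= S}, size w = j + size w' &
                 \prod_(s <- w) s = x ^+ j * \prod_(s <- w') s].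
Proof.
move=> + xS; elim: j w => [|j ih] w wS; first by exists w; rewrite mul1g.
move=> le_jw; have xw : x \in w by rewrite -has_pred1 has_count (leq_trans _ le_jw).
case/splitPr: xw wS le_jw => w1 w2 wS.
pose w' := map (conjg^~ x) w1 ++ w2.
have w'S : {subset w' <= S}.
  move=> s; rewrite mem_cat => /orP[/mapP[y yw ->]|sw].
    by apply: conj_gen; apply: wS; rewrite mem_cat yw.
  by apply: wS; rewrite mem_cat inE sw !orbT.
have cw : count_mem x (w1 ++ x :: w2) = (count_mem x w').+1.
  rewrite !count_cat /= eqxx add1n addnS count_map; congr (_ + _).+1.
  apply: eq_count => y /=; rewrite -[in LHS](inj_eq (conjg_inj x)).
  by rewrite [x ^ x]conjgE mulKg.
rewrite cw ltnS => le_jw.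
have [w'' [w''S sz pr]] := ih w' w'S le_jw.
exists w''; split=> //.
  by move: sz; rewrite !size_cat size_map /= addnS addSn => ->.
rewrite expgS -mulgA -pr /w' !big_cat big_cons /= big_map -conjg_prod.
by rewrite mulgA (conjgC _ x) -mulgA.
Qed.

Lemma dietzmann e : 0 < e -> {in S, forall s, s ^+ e = 1} ->
  finite_set [set: T]%classic.
Proof.
move=> e0 Se.
pose L := (size (undup S) * e)%N.
pose ev (w : L.-bseq (seq_sub S)) : T := \prod_(s <- w) val s.
suff ev_onto t : exists w, t = ev w.
  have -> : [set: T]%classic = (ev @` [set: _])%classic.
    by apply/seteqP; split=> // t _; have [w ->] := ev_onto t; exists w.
  exact/finite_image/finite_finset.
have [w wS ->] : exists2 w : seq T, {subset w <= S} & t = \prod_(s <- w) s.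
  elim/S_gen: t => [|s t sS [w wS ->]|s t sS [w wS ->]].
  - by exists [::]; rewrite ?big_nil.
  - exists (s :: w); last by rewrite big_cons.
    by move=> x; rewrite inE => /predU1P[->|/wS].
  (* Inverse letters are eliminated by [s^-1 = s ^+ e.-1]. *)
  - exists (nseq e.-1 s ++ w).
      by move=> x; rewrite mem_cat => /orP[/nseqP[->]|/wS].
    rewrite big_cat; congr (_ * _); rewrite big_nseq iter_mulg_1.
    by apply: mulg1_eq; rewrite -expgS prednK // Se.
have [n] := ubnP (size w); elim: n w wS => // n ih w wS le_wn.
have [small|] := leqP (size w) L.
  pose v := pmap insub w : seq (seq_sub S).
  have vE : map val v = w.
    rewrite pmap_filter; last exact: insubK.
    by apply/all_filterP/allP => x /wS xS; rewrite insubT.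
  have sz : size v <= L by rewrite -(size_map val) vE.
  by exists (Bseq sz); rewrite /ev /= -[in LHS]vE big_map.
move=> big.
(* Pigeonhole: a word longer than [L] repeats some letter at least [e] times. *)
have [x xS le_x] : exists2 x, x \in S & e <= count_mem x w.
  apply: contrapT => no.
  suff : size w <= L by rewrite leqNgt big.
  have -> : size w = (\sum_(x <- undup S) count_mem x w)%N.
    elim: w wS {ih le_wn big no} => [|y w ih] wS; first by rewrite big1.
    rewrite /= big_split /= -ih => [|x xw]; last by apply: wS; rewrite inE xw orbT.
    have yS : y \in undup S by rewrite mem_undup wS ?mem_head.
    transitivity (count_mem y (undup S) + size w)%N.
      by rewrite count_uniq_mem ?undup_uniq // yS.
    rewrite -sum1_count big_mkcond; congr (_ + _)%N.
    by apply: eq_bigr => x _; rewrite /= eq_sym; case: eqP.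
  rewrite /L -sum1_size big_distrl /= big_seq [leqRHS]big_seq.
  apply: leq_sum => x; rewrite mem_undup mul1n => xS.
  by rewrite leqNgt; apply/negP => /ltnW lt; apply: no; exists x.
have [w' [w'S sz ->]] := count_front wS xS le_x.
rewrite Se // mul1g; apply: ih => //.
by rewrite -ltnS (leq_trans _ le_wn) // sz ltnS -add1n leq_add2r.
Qed.

(** With [s ^+ m] central and [k] the exponent of the transfer on the centre, the transfer of
    [s ^+ m] is [s ^+ (m * k)]; being killed by [n], it gives [s ^+ (m * k * n) = 1]. *)
Lemma finite_of_torsion_generators n : 0 < n ->
  (forall (V : zmodType) (v : T -> V), {morph v : t u / t * u >-> (t + u)%R} ->
    {in S, forall s, v s *+ n = 0}%R) ->
  finite_set [set: T]%classic.
Proof.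
move=> n0 tors.
have [k k0 trk] := transfer_central conj_actionP.
have [m m0 expm] := exp_central conj_actionP.
apply: (@dietzmann (m * k * n)); rewrite ?muln_gt0 ?m0 ?k0 // => s sS.
have trX j : transfer conj_actionP (s ^+ j) = (transfer conj_actionP s *+ j)%R.
  elim: j => [|j ih]; last by rewrite expgS transferM ih GRing.mulrS.
  apply: (GRing.addrI (transfer conj_actionP (s ^+ 0))).
  by rewrite -transferM mulg1 GRing.addr0.
have := tors _ _ (transferM conj_actionP) s sS.
move/(congr1 (fun z => z *+ m)%R); rewrite GRing.mul0rn -GRing.mulrnA mulnC.
rewrite GRing.mulrnA -trX (trk (to_center (expm s))) -GRing.mulrnA => /(congr1 val).
by rewrite val_centerMn /= -expgnA mulnA.
Qed.

End ConjugationClosed.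

(** * Finiteness of the tensor product *)

Section Tensor.
Variables (G A : finGroupType).
Variables (alpha : left_action G A) (beta : left_action A G).
Notation T := (tensor_product alpha beta).
Notation "g (x) a" := (tensor alpha beta g a) (at level 30).

Lemma to_tensor_relation u v : tensor_relation alpha beta u v ->
  to_quotient (normal_closure (tensor_relators alpha beta)) u = to_quotient _ v.
Proof.
by move=> uv; apply/to_quotientP => N [_]; apply; exists u, v.
Qed.

Lemma tensorMl g g' a :
  (g * g') (x) a = (lconj g g' (x) alpha g a) * (g (x) a).
Proof. by rewrite -to_quotientM; exact/to_tensor_relation/TensorMl. Qed.

Lemma tensorMr g a a' :
  g (x) (a * a') = (g (x) a) * (beta a g (x) lconj a a').
Proof. by rewrite -to_quotientM; exact/to_tensor_relation/TensorMr. Qed.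

Lemma tensorJ g a g' a' : exists h b,
  (g (x) a) * (g' (x) a') * (g (x) a)^-1 = h (x) b.
Proof.
exists (freeprod_actG beta (mixed_comm g a) g').
exists (freeprod_actA alpha (mixed_comm g a) a').
rewrite -to_quotientV -(to_quotientM _ (free_gen (g, a))) -to_quotientM.
exact/to_tensor_relation/TensorJ.
Qed.

Lemma tensor_gen (P : T -> Prop) : P 1 ->
  (forall g a t, P t -> P ((g (x) a) * t)) ->
  (forall g a t, P t -> P ((g (x) a)^-1 * t)) -> forall t, P t.
Proof.
move=> P1 PM PV t; rewrite -(quotient_reprK t) -(free_reprK (quotient_repr t)).
elim: (free_repr _) => [//|[[g a] b] w ih].
have -> : of_word ((g, a, b) :: w)
  = (if b then free_gen (g, a) else (free_gen (g, a))^-1) * of_word w.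
  by case: b; rewrite ?[(free_gen _)^-1]free_invE [RHS]free_mulE.
by rewrite to_quotientM; case: b; rewrite ?to_quotientV; [exact: PM|exact: PV].
Qed.

Lemma tensor_torsion (V : zmodType) (v : T -> V) :
  {morph v : t u / t * u >-> (t + u)%R} ->
  forall g a, (v (g (x) a) *+ (#|G| * #|A|) = 0)%R.
Proof.
move=> vM g a; pose x b := (\sum_(h : G) v (h (x) b))%R.
have lconj_inj (K : groupType) (k : K) : injective (lconj k).
  exact: can_inj (lconjK k).
have xl h b : x b = (x (alpha h b) + v (h (x) b) *+ #|G|)%R.
  rewrite {1}/x (reindex_inj (mulgI h)) /=.
  under eq_bigr => k _ do rewrite tensorMl vM.
  rewrite big_split /= GRing.sumr_const; congr (_ + _)%R.
  by rewrite /x [RHS](reindex_inj (lconj_inj _ h)).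
have xr b b' : x (b * b') = (x b + x (lconj b b'))%R.
  rewrite {1}/x; under eq_bigr => k _ do rewrite tensorMr vM.
  rewrite big_split /=; congr (_ + _)%R.
  by rewrite /x [RHS](reindex_inj (can_inj (lactK beta b))).
have xM b b' : x (b * b') = (x b + x b')%R.
  (* In this form the conjugation produced by [xr] cancels. *)
  have -> : b * b' = b' * lconj b'^-1 b by rewrite /lconj invgK !mulgA mulgV mul1g.
  by rewrite xr lconjVK GRing.addrC.
have xX b j : x (b ^+ j) = (x b *+ j)%R.
  elim: j => [|j ih]; last by rewrite expgS xM ih GRing.mulrS.
  by apply: (GRing.addrI (x (b ^+ 0))); rewrite -xM mulg1 GRing.addr0.
have xA b : (x b *+ #|A| = 0)%R.
  rewrite -xX -cardsT (expg_cardG (G := [set: A]%G)) ?(xX b 0) //.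
  exact: finset.in_setT.
(* Multiplying [xl] by [#|A|] kills both values of [x]. *)
have := congr1 (fun z => z *+ #|A|)%R (xl g a).
by rewrite GRing.mulrnDl !xA GRing.add0r GRing.mulrnA => <-.
Qed.

Lemma finite_tensor : finite_set [set: T]%classic.
Proof.
pose S := [seq p.1 (x) p.2 | p : G * A].
have SP g a : g (x) a \in S by apply/fintype.imageP; exists (g, a).
apply: (@finite_of_torsion_generators _ S _ _ (#|G| * #|A|)).
- move=> _ _ /fintype.imageP[[g a] _ ->] /fintype.imageP[[g' a'] _ ->] /=.
  have [h [b e]] := tensorJ g a g' a'.
  by rewrite conjgE invgK mulgA e.
- move=> P P1 PM PV; apply: tensor_gen => // g a t Pt; first exact: PM.
  exact: PV.
- by rewrite muln_gt0 -!cardsT !cardG_gt0.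
- by move=> V v vM _ /fintype.imageP[[g a] _ ->]; exact: tensor_torsion.
Qed.

End Tensor.

(** * Finiteness of the homology groups *)

Theorem corollary6p5 (G A : finGroupType)
    (alpha : left_action G A) (beta : left_action A G)
    (hc : half_compatible alpha beta) :
  finite_set [set: H0 alpha beta]%classic /\ finite_set [set: H1 alpha beta]%classic.
Proof.
split.
  (* [H0] is an iterated quotient of the finite group [A]. *)
  have -> : [set: H0 alpha beta]%classic =
    ((fun a : A => to_quotient (f_hom_image alpha beta)
        (to_quotient (A' alpha beta) a)) @` [set: A])%classic.
    apply/seteqP; split=> // q _; exists (quotient_repr (quotient_repr q)) => //.
    by rewrite !quotient_reprK.
  exact/finite_image/finite_finset.
(* [H1] embeds into the finite tensor product. *)
apply: (finite_preimage (f := @H1_val _ _ alpha beta) _ (finite_tensor alpha beta)).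
by move=> x y _ _; exact: val_inj.
Qed.
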